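(* Let $n>4$, let $0\le k\le n-3$, and let $\mathbf{c}_0=(1,1,\underbrace{0,\ldots,0}_{k},1,0,0,\ldots,0)\in\mathbb{N}^n$ be the initial configuration on the directed cycle $C_n$ whose entries equal to $1$ are exactly those in positions $1$, $2$ and $k+3$, all others being $0$. Then $$\mathcal{A}(C_n,\mathbf{c}_0)\simeq\begin{cases}S^1, & \text{if } k=0 \text{ or } k=n-3,\\ S^1, & \text{if } n \text{ is odd and } k=\frac{n-3}{2},\\ \bigvee_{\frac n2+1}S^1, & \text{if } n \text{ is even and } k\in\{\frac n2-2,\frac n2-1\},\\ \bigvee_{n+1}S^1, & \text{otherwise.}\end{cases}$$
   Context: $\mathbb{N}$ includes $0$. $C_n$ is the directed cycle with vertices $v_1,\dots,v_n$ and edges $(v_i,v_{i+1})$, indices modulo $n$; every vertex has out-degree $1$ and there are no sinks. A configuration is a vector $\mathbf{c}\in\mathbb{N}^n$, where $\mathbf{c}(v_i)$ is the number of grains on $v_i$. Parallel-firing sandpile dynamics started from $\mathbf{c}_0$: at each time $t=0,1,2,\dots$ the firing set $\sigma_t$ is the set of vertices $v_i$ with $\mathbf{c}_t(v_i)\ge 1$; all of these fire simultaneously, each sending one grain to its out-neighbour, so that $\mathbf{c}_{t+1}(v_i)=\mathbf{c}_t(v_i)-[v_i\in\sigma_t]+[v_{i-1}\in\sigma_t]$ (where $[\cdot]$ is $1$ if the condition holds and $0$ otherwise). The avalanche complex $\mathcal{A}(C_n,\mathbf{c}_0)$ is the simplicial complex generated by the firing sets, i.e. the simplices are all nonempty subsets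 of the sets $\sigma_t$, $t\ge 0$ (vertices that never fire are not vertices of the complex). $\simeq$ denotes homotopy equivalence, and $\bigvee_m X$ is the wedge of $m$ copies of $X$. *)

(* Defs.v *)
From mathcomp Require Import all_boot all_order all_algebra.
From mathcomp Require Import all_classical all_reals all_analysis.
From mathcomp Require Import homotopy.

Set Implicit Arguments.
Unset Strict Implicit.
Unset Printing Implicit Defensive.
Import Order.TTheory GRing.Theory Num.Theory numFieldNormedType.Exports.
Local Open Scope classical_set_scope.
Local Open Scope ring_scope.

(* The vertex v_(i+1) of C_n is represented by [i : 'I_n], and [ord_pred i]
   is its unique in-neighbour (predecessor modulo n). *)
Definition config (n : nat) := {ffun 'I_n -> nat}.

Definition firing (n : nat) (c : config n) : {set 'I_n} :=
  [set i | (1 <= c i)%N]%SET.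

(* The truncated subtraction is exact, as a firing vertex has a grain. *)
Definition step (n : nat) (c : config n) : config n :=
  [ffun i => (c i - (i \in firing c) + (ord_pred i \in firing c))%N].

Definition firing_at (n : nat) (c0 : config n) (t : nat) : {set 'I_n} :=
  firing (iter t (@step n) c0).

(* A complex is the set of its simplices, which are nonempty; a vertex of the
   ambient 'I_n belongs to the complex only if its singleton is a simplex. *)
Definition generated_complex (n : nat) (F : set {set 'I_n}) :
    set {set 'I_n} :=
  [set s | s != finset.set0 /\ exists2 f, F f & s \subset f].

Definition avalanche_complex (n : nat) (c0 : config n) : set {set 'I_n} :=
  generated_complex (range (firing_at c0)).

(* Geometric realization, in barycentric coordinates. The vertex set being
   finite, the weak topology is the one induced by R^n. *)
Definition barycentric_points (R : realType) (n : nat) (K : set {set 'I_n}) :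
    set 'rV[R]_n :=
  [set x | [/\ forall i, 0 <= x ord0 i, \sum_i x ord0 i = 1
             & K [set i | x ord0 i != 0]%SET]].
Arguments barycentric_points R {n} K _.

Definition realization (R : realType) (n : nat) (K : set {set 'I_n}) :
    topologicalType :=
  set_type (barycentric_points R K).

Definition homotopic (R : realType) (X Y : topologicalType) (f g : X -> Y) :=
  exists H : X * R -> Y,
    [/\ {within [set: X] `*` `[0, 1], continuous H},
        forall x, H (x, 0) = f x & forall x, H (x, 1) = g x].

Definition homotopy_equivalent (R : realType) (X Y : topologicalType) :=
  exists (f : X -> Y) (g : Y -> X),
    [/\ continuous f, continuous g, homotopic R (g \o f) idfun
      & homotopic R (f \o g) idfun].

Definition unit_circle (R : realType) : set (R * R) :=
  [set p | p.1 ^+ 2 + p.2 ^+ 2 = 1].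
Arguments unit_circle R _ : clear implicits.

Definition circle (R : realType) : topologicalType :=
  set_type (unit_circle R).

Lemma circle_base_subproof (R : realType) :
  ((1, 0) : R * R) \in unit_circle R.
Proof. by rewrite inE /unit_circle /= expr1n expr0n addr0. Qed.

Definition circle_base (R : realType) : circle R :=
  exist _ ((1, 0) : R * R) (circle_base_subproof R).

(* The bouquet of m circles; for m = 0 this is empty, not a point. *)
Definition bouquet (R : realType) (m : nat) : topologicalType :=
  wedge (fun _ : 'I_m => circle_base R).

(* (1, 1, 0^k, 1, 0, ...): positions 1, 2 and k + 3, counted from 1. *)
Definition init_config (n k : nat) : config n :=
  [ffun i : 'I_n => ((i : nat) \in [:: 0; 1; k.+2]%N) : nat].

(* Main.v *)
Require Import Defs.
From mathcomp Require Import all_boot all_order all_algebra.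
From mathcomp Require Import all_classical all_reals all_analysis.
From mathcomp Require Import homotopy zify ring lra.

Set Implicit Arguments.
Unset Strict Implicit.
Unset Printing Implicit Defensive.
Import Order.TTheory GRing.Theory Num.Theory numFieldNormedType.Exports.
Local Open Scope classical_set_scope.
Local Open Scope ring_scope.

(** No vertex ever holds two grains, so every grain moves one step at each time
    and the firing sets are the rotations {i, i + 1, i + k + 2} of the first one.
    The complex is thus generated by [n] triangles whose sides are steps of
    lengths 1, k + 1 and k + 2 modulo [n].

    In each case some length occurs only once, among the three lengths up to
    sign, and is not half of [n]. Every edge of that length then belongs to one
    triangle only, and all triangles can be collapsed at once through these free
    edges onto their two other sides ([collapse_equivalent]). The collapse is
    given by a formula in barycentric coordinates, and straight segments deform
    the identity to it.

    What remains is a connected graph with a Hamiltonian cycle and some chords: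
    no chord for k = 0 and k = n - 3, nor for n = 2 k + 3, where the edges of
    length 1 are free and the others form a single cycle of steps k + 2; n / 2
    chords if k + 1 or k + 2 is half of [n], for two opposite steps then give one
    chord; and [n] chords otherwise. One edge of the cycle is cut to leave a
    Hamiltonian path, which is a maximal tree. Contracting this path shows that the graph is
    a bouquet with one petal for each chord and one for the cut edge
    ([hamiltonian_graph_equivalent]).

    The contraction is explicit. The tour of a chord starts at the origin of the
    path, follows the path to one end of the chord, crosses the chord, and comes
    back along the path. One map sends each petal around the tour of its chord;
    the other pinches the path to the base point and sends each chord once around
    its petal. Both composites are deformed to the identity by a change of speed
    along the tours and along the petals, together with the retreat of the path
    to its origin. The continuity of these maps is checked on the finitely many
    closed pieces on which they are given by formulas. *)

(** * Continuity by pieces and by coordinates *)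

Lemma paste_continuous (I : finType) (X Y : topologicalType) (C : I -> set X)
    (phi : I -> X -> Y) (f : X -> Y) :
  (forall i, closed (C i)) -> (forall x, exists i, C i x) ->
  (forall i, continuous (phi i)) -> (forall i x, C i x -> f x = phi i x) ->
  continuous f.
Proof.
move=> cC coverC cphi fE; apply/continuous_closedP => D cD.
have -> : f @^-1` D = \bigcup_(i in [set: I]) (C i `&` phi i @^-1` D).
  apply/seteqP; split=> x /=.
    have [i Cix] := coverC x.
    by move=> Dfx; exists i => //; split=> //=; rewrite -fE.
  by case=> i _ [Cix] /=; rewrite -fE.
apply: closed_bigcup; first exact: finite_finset.
move=> i _; apply: closedI; first exact: cC.
by move/continuous_closedP: (cphi i); apply.
Qed.

Section RealValued.
Context {R : realType} {X : topologicalType}.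
Implicit Types f g : X -> R.

Lemma continuous_add f g :
  continuous f -> continuous g -> continuous (fun x => f x + g x).
Proof. by move=> cf cg x; apply: (@continuousD R R^o); [exact: cf|exact: cg]. Qed.

Lemma continuous_opp f : continuous f -> continuous (fun x => - f x).
Proof. by move=> cf x; apply: (@continuousN R R^o); exact: cf. Qed.

Lemma continuous_sub f g :
  continuous f -> continuous g -> continuous (fun x => f x - g x).
Proof. by move=> cf cg; apply: continuous_add => //; exact: continuous_opp. Qed.

Lemma continuous_mul f g :
  continuous f -> continuous g -> continuous (fun x => f x * g x).
Proof. by move=> cf cg x; apply: continuousM; [exact: cf|exact: cg]. Qed.

Lemma continuous_maxr f g :
  continuous f -> continuous g -> continuous (fun x => Num.max (f x) (g x)).
Proof. by move=> cf cg x; apply: continuous_max; [exact: cf|exact: cg]. Qed.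

Lemma continuous_minr f g :
  continuous f -> continuous g -> continuous (fun x => Num.min (f x) (g x)).
Proof. by move=> cf cg x; apply: continuous_min; [exact: cf|exact: cg]. Qed.

Lemma continuous_sqrtr f : continuous f -> continuous (fun x => Num.sqrt (f x)).
Proof.
by move=> cf x; apply: continuous_comp; [exact: cf|exact: sqrt_continuous].
Qed.

Lemma continuous_normr f : continuous f -> continuous (fun x => `|f x|).
Proof.
move=> cf x; apply: continuous_comp; first exact: cf.
exact: (@norm_continuous _ R^o).
Qed.

Lemma continuous_sumr (I : finType) (F : I -> X -> R) :
  (forall i, continuous (F i)) -> continuous (fun x => \sum_i F i x).
Proof.
move=> cF; rewrite /index_enum; elim: (Finite.enum I) => [|i s IHs].
  by under eq_fun do rewrite big_nil; exact: cst_continuous.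
under eq_fun do rewrite big_cons.
by apply: continuous_add; [exact: cF|exact: IHs].
Qed.

Lemma closed_ge0 f : continuous f -> closed [set x | 0 <= f x].
Proof.
by move=> /continuous_closedP /(_ _ (@closed_ge R 0)).
Qed.

Lemma closed_le0 f : continuous f -> closed [set x | f x <= 0].
Proof.
by move=> /continuous_closedP /(_ _ (@closed_le R 0)).
Qed.

Lemma closed_eq0 f : continuous f -> closed [set x | f x = 0].
Proof.
by move=> /continuous_closedP /(_ _ (@closed_eq R 0)).
Qed.

(** The sign of a continuous function cuts a space into two closed pieces. *)
Lemma paste_sign_continuous (Y : topologicalType) (s : X -> R)
    (phi psi f : X -> Y) :
  continuous s -> continuous phi -> continuous psi ->
  (forall x, 0 <= s x -> f x = phi x) -> (forall x, s x <= 0 -> f x = psi x) ->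
  continuous f.
Proof.
move=> cs cphi cpsi fphi fpsi.
apply: (@paste_continuous bool _ _
  (fun b => if b then [set x | 0 <= s x] else [set x | s x <= 0])
  (fun b => if b then phi else psi)).
- by case; [exact: closed_ge0|exact: closed_le0].
- by move=> x; have [s0|s0] := lerP 0 (s x); [exists true|exists false; apply/ltW].
- by case.
- by case=> x /=; [exact: fphi|exact: fpsi].
Qed.

Lemma continuous_row (n : nat) (F : X -> 'rV[R]_n) :
  (forall j, continuous (fun x => F x ord0 j)) -> continuous F.
Proof.
move=> cF x; apply/cvg_ballP => e e0.
have /filter_forall : forall j, \forall y \near x,
    ball (F x ord0 j) e (F y ord0 j).
  by move=> j; move/cvg_ballP: (cF j x); apply.
by apply: filterS => y Fy; split=> // i j; rewrite (ord1 i).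
Qed.

End RealValued.

Lemma continuous_pair (X Y Z : topologicalType) (f : X -> Y) (g : X -> Z) :
  continuous f -> continuous g -> continuous (fun x => (f x, g x)).
Proof. by move=> cf cg x; apply: cvg_pair; [exact: cf|exact: cg]. Qed.

Lemma continuous_after (X Y Z : topologicalType) (g : Y -> Z) (f : X -> Y) :
  continuous g -> continuous f -> continuous (fun x => g (f x)).
Proof.
by move=> cg cf x; apply: (@continuous_comp _ _ _ f g); [exact: cf|exact: cg].
Qed.

Lemma continuous_fst (X Y : topologicalType) : continuous (@fst X Y).
Proof. by move=> x; exact: cvg_fst. Qed.

Lemma continuous_snd (X Y : topologicalType) : continuous (@snd X Y).
Proof. by move=> x; exact: cvg_snd. Qed.

Lemma continuous_set_val (Y : topologicalType) (B : set Y) :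
  continuous (set_val : B -> Y).
Proof. exact: initial_continuous. Qed.

Lemma continuous_in_set (X Y : topologicalType) (B : set Y) (f : X -> B) :
  continuous (fun x => set_val (f x)) -> continuous f.
Proof. exact: (@continuous_comp_initial B X Y set_val). Qed.

(** * Homotopies indexed by the whole line *)

Section LineHomotopy.
Context (R : realType).
Implicit Types X Y Z W : topologicalType.

(** A homotopy over [0, 1] extends to all times by clamping the time. Asking
    for the extended map spares subspace topologies on the time axis. *)
Definition line_homotopic X Y (f g : X -> Y) :=
  exists H : X * R -> Y,
    [/\ continuous H, forall x, H (x, 0) = f x & forall x, H (x, 1) = g x].

Definition line_equivalent X Y :=
  exists (f : X -> Y) (g : Y -> X),
    [/\ continuous f, continuous g, line_homotopic (g \o f) idfun
      & line_homotopic (f \o g) idfun].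

Lemma line_equivalentW X Y : line_equivalent X Y -> homotopy_equivalent R X Y.
Proof.
have W (U : topologicalType) (f g : U -> U) : line_homotopic f g -> homotopic R f g.
  by case=> H [cH H0 H1]; exists H; split=> //; exact: continuous_subspaceT.
by case=> f [g [cf cg gf fg]]; exists f, g; split=> //; exact: W.
Qed.

Lemma line_homotopic_eq X Y (f g : X -> Y) :
  continuous g -> f =1 g -> line_homotopic f g.
Proof.
move=> cg fg; exists (fun p => g p.1); split=> //.
by apply: continuous_after => //; exact: continuous_fst.
Qed.

Lemma line_homotopic_comp X Y Z W (a : X -> Y) (f g : Y -> Z) (b : Z -> W) :
  continuous a -> continuous b -> line_homotopic f g ->
  line_homotopic (b \o f \o a) (b \o g \o a).
Proof.
move=> ca cb [H [cH H0 H1]]; exists (fun p => b (H (a p.1, p.2))); split.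
- apply: continuous_after => //; apply: continuous_after => //.
  apply: continuous_pair; last exact: continuous_snd.
  by apply: continuous_after => //; exact: continuous_fst.
- by move=> x /=; rewrite H0.
- by move=> x /=; rewrite H1.
Qed.

Lemma line_homotopic_trans X Y (f g h : X -> Y) :
  line_homotopic f g -> line_homotopic g h -> line_homotopic f h.
Proof.
move=> [H [cH H0 H1]] [K [cK K0 K1]].
exists (fun p => if 2 * p.2 - 1 <= 0 then H (p.1, 2 * p.2)
                 else K (p.1, 2 * p.2 - 1)).
have c2 : continuous (fun p : X * R => 2 * p.2).
  by apply: continuous_mul; [exact: cst_continuous|exact: continuous_snd].
have c21 : continuous (fun p : X * R => 2 * p.2 - 1).
  by apply: continuous_sub => //; exact: cst_continuous.
split.
- apply: (@paste_sign_continuous R (X * R)%type Y (fun p => 2 * p.2 - 1)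
    (fun p => K (p.1, 2 * p.2 - 1)) (fun p => H (p.1, 2 * p.2))) => //.
  + by apply: continuous_after => //; apply: continuous_pair => //;
      exact: continuous_fst.
  + by apply: continuous_after => //; apply: continuous_pair => //;
      exact: continuous_fst.
  + move=> [x t] /= t0; case: ifPn => // t0'.
    have -> : 2 * t = 1 by lra.
    by rewrite subrr H1 K0.
  + by move=> [x t] /= ->.
- by move=> x /=; rewrite mulr0 ifT ?H0//; lra.
- move=> x /=; rewrite mulr1 ifF; last by apply/negbTE; lra.
  by have -> : 2 - 1 = 1 :> R by ring.
Qed.

Lemma line_equivalent_trans X Y Z :
  line_equivalent X Y -> line_equivalent Y Z -> line_equivalent X Z.
Proof.
move=> [f [g [cf cg gf fg]]] [f' [g' [cf' cg' gf' fg']]].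
exists (f' \o f), (g \o g'); split.
- exact: continuous_after.
- exact: continuous_after.
- exact: line_homotopic_trans (line_homotopic_comp cf cg gf') gf.
- exact: line_homotopic_trans (line_homotopic_comp cg' cf' fg) fg'.
Qed.

End LineHomotopy.

(** * The circle as a closed path, and the bouquet *)

Section Circle.
Context (R : realType).

Definition clamp (b t : R) : R := Num.max 0 (Num.min b t).

Lemma clamp_id (b t : R) : 0 <= t <= b -> clamp b t = t.
Proof. by rewrite /clamp; case/andP=> t0 tb; rewrite min_r // max_r. Qed.

Lemma clamp_le0 (b t : R) : t <= 0 -> clamp b t = 0.
Proof. by move=> t0; rewrite /clamp max_l// ge_min t0 orbT. Qed.

Lemma clamp_ge (b t : R) : 0 <= b -> b <= t -> clamp b t = b.
Proof. by move=> b0 bt; rewrite /clamp min_l// max_r. Qed.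

Lemma clamp_itv (b t : R) : 0 <= b -> 0 <= clamp b t <= b.
Proof.
by move=> b0; rewrite /clamp le_max lexx ge_max b0 ge_min lexx.
Qed.

Lemma continuous_clamp (X : topologicalType) (b : R) (f : X -> R) :
  continuous f -> continuous (fun x => clamp b (f x)).
Proof.
move=> cf; apply: continuous_maxr; first exact: cst_continuous.
by apply: continuous_minr => //; exact: cst_continuous.
Qed.

(** At most one of the two clamped numbers is nonzero, so that this is the point
    of first coordinate [|s| - 1] on the half circle given by the sign of [s]. *)
Definition wind_coord (s : R) : R * R :=
  (clamp 2 s + clamp 2 (- s) - 1,
   Num.sqrt (1 - (clamp 2 s - 1) ^+ 2) - Num.sqrt (1 - (clamp 2 (- s) - 1) ^+ 2)).

Lemma wind_coord_ge0 (s : R) : 0 <= s -> wind_coord s =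
  (clamp 2 s - 1, Num.sqrt (1 - (clamp 2 s - 1) ^+ 2)).
Proof.
move=> s0; rewrite /wind_coord [clamp 2 (- s)]clamp_le0; last by lra.
by rewrite addr0 sub0r sqrrN expr1n subrr sqrtr0 subr0.
Qed.

Lemma wind_coordN (s : R) :
  wind_coord (- s) = ((wind_coord s).1, - (wind_coord s).2).
Proof. by rewrite /wind_coord opprK /= [_ + clamp 2 s]addrC opprB. Qed.

Lemma wind_coord_circle (s : R) :
  (wind_coord s).1 ^+ 2 + (wind_coord s).2 ^+ 2 = 1.
Proof.
wlog s0 : s / 0 <= s.
  move=> wl; have [s0|/ltW s0] := lerP 0 s; first exact: wl.
  have -> : s = - - s by rewrite opprK.
  rewrite wind_coordN [X in _ + X]sqrrN; apply: wl; lra.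
have := @clamp_itv 2 s; set c := clamp 2 s => /(_ ltac:(lra)) c02.
rewrite wind_coord_ge0 //= sqr_sqrtr; first by ring.
by rewrite -/c; nra.
Qed.

Lemma wind_subproof (s : R) : wind_coord s \in unit_circle R.
Proof. by rewrite inE; exact: wind_coord_circle. Qed.

(** The full turn around the circle, run over [-2, 2] and stopped outside. It
    starts and ends at the base point, and is at the opposite point at 0. The
    first coordinate is affine in the absolute value of the parameter, so that
    no angle is needed. *)
Definition wind (s : R) : circle R := exist _ (wind_coord s) (wind_subproof s).

Lemma continuous_wind : continuous wind.
Proof.
have cid : continuous (fun s : R => s) by move=> s; exact: cvg_id.
have c1 : continuous (fun _ : R => 1 : R) by move=> s; exact: cvg_cst.
have cc : continuous (clamp 2) by exact: continuous_clamp.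
have ccN : continuous (fun s : R => clamp 2 (- s)).
  by apply: continuous_clamp; exact: continuous_opp.
have cq (f : R -> R) : continuous f ->
    continuous (fun s => Num.sqrt (1 - (f s - 1) ^+ 2)).
  move=> cf; apply: continuous_sqrtr; apply: continuous_sub => //.
  under eq_fun do rewrite expr2.
  by apply: continuous_mul; exact: continuous_sub.
apply: continuous_in_set => /=; apply: continuous_pair.
- by apply: continuous_sub => //; exact: continuous_add.
- by apply: continuous_sub; exact: cq.
Qed.

Lemma circle_normE (p : circle R) : (\val p).1 ^+ 2 + (\val p).2 ^+ 2 = 1.
Proof. by have := set_valP p. Qed.

Lemma circle_baseP (p : circle R) : (\val p).1 = 1 -> p = circle_base R.
Proof.
move=> p1; apply: val_inj; move: p1 (circle_normE p).
case: (\val p) => a b /= ->; rewrite expr1n => /eqP.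
by rewrite addrC -subr_eq0 addrK sqrf_eq0 => /eqP ->.
Qed.

Lemma wind_base (s : R) : 2 <= `|s| -> wind s = circle_base R.
Proof.
move=> s2; apply: circle_baseP => /=; move: s2.
case: (lerP 0 s) => s0 s2; rewrite ?(ger0_norm s0) ?(ltr0_norm s0) in s2.
  by rewrite clamp_ge // clamp_le0; lra.
by rewrite clamp_le0 ?clamp_ge; lra.
Qed.

(** The inverse of the full turn; it jumps from 2 to -2 at the base point. *)
Definition unwind (p : circle R) : R :=
  if 0 <= (\val p).2 then 1 + (\val p).1 else - (1 + (\val p).1).

Lemma unwindK : cancel unwind wind.
Proof.
move=> p; apply: val_inj; rewrite /unwind /=; have := circle_normE p.
case: p => -[a b] /= _ ab.
have [a1 a1'] : -1 <= a /\ a <= 1 by split; nra.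
have sq : 1 - (clamp 2 (1 + a) - 1) ^+ 2 = b ^+ 2.
  by rewrite clamp_id; [rewrite -ab; ring|lra].
have cE : clamp 2 (1 + a) - 1 = a by rewrite clamp_id; [ring|lra].
case: ifPn => b0; last rewrite wind_coordN.
  by rewrite wind_coord_ge0 ?sq ?sqrtr_sqr ?ger0_norm ?cE //; lra.
rewrite -ltNge in b0.
by rewrite wind_coord_ge0 ?sq ?sqrtr_sqr ?ltr0_norm ?cE ?opprK //=; lra.
Qed.

Lemma windK (s : R) : `|s| < 2 -> unwind (wind s) = s.
Proof.
rewrite ltr_norml => /andP[s2 s2']; rewrite /unwind -![\val (wind s)]/(wind_coord s).
have [s0|s0] := lerP 0 s.
  rewrite wind_coord_ge0 //= sqrtr_ge0 clamp_id; last by lra.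
  by ring.
have -> : s = - - s by rewrite opprK.
rewrite wind_coordN wind_coord_ge0 /=; last by lra.
rewrite clamp_id; last by lra.
rewrite ifF; first by ring.
by rewrite oppr_ge0; apply/negbTE; rewrite -ltNge sqrtr_gt0; nra.
Qed.

(** The jump of [unwind] goes unnoticed by a path over [-2, 2] whose two ends
    agree, so that closed paths descend to the circle, also in families. *)
Lemma continuous_unwind (X Y : topologicalType) (p : X -> circle R)
    (K : R * X -> Y) :
  continuous p -> continuous K -> (forall x, K (2, x) = K (-2, x)) ->
  continuous (fun x => K (unwind (p x), x)).
Proof.
move=> cp cK K2.
have cv : continuous (fun x => \val (p x)).
  by apply: continuous_after cp; exact: continuous_set_val.
have c1 : continuous (fun x => 1 + (\val (p x)).1).
  apply: continuous_add; first exact: cst_continuous.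
  by apply: continuous_after cv; exact: continuous_fst.
have cK' (f : X -> R) : continuous f -> continuous (fun x => K (f x, x)).
  move=> cf; apply: continuous_after => //; apply: continuous_pair => //.
  by move=> x; exact: cvg_id.
apply: (@paste_sign_continuous R X Y (fun x => (\val (p x)).2)
  (fun x => K (1 + (\val (p x)).1, x)) (fun x => K (- (1 + (\val (p x)).1), x))).
- by apply: continuous_after cv; exact: continuous_snd.
- exact: cK'.
- by apply: cK'; exact: continuous_opp.
- by move=> x p0; rewrite /unwind p0.
- move=> x p0; rewrite /unwind; case: ifPn => // p0'.
  have := circle_normE (p x).
  have -> : (\val (p x)).2 = 0 by apply/le_anti; rewrite p0 p0'.
  rewrite expr0n addr0 => /eqP; rewrite sqrf_eq1 => /orP[]/eqP ->.
    exact: K2.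
  by rewrite subrr oppr0.
Qed.

Section Bouquet.
Context (m : nat).

Definition petal (j : 'I_m) (p : circle R) : bouquet R m :=
  @wedge_lift _ _ (fun _ : 'I_m => circle_base R) j p.

Lemma continuous_petal j : continuous (petal j).
Proof. exact: (@wedge_lift_continuous _ _ (fun _ : 'I_m => circle_base R) j). Qed.

Lemma petal_base i j : petal i (circle_base R) = petal j (circle_base R).
Proof.
exact: (@wedge_liftE _ _ (fun _ : 'I_m => circle_base R) j (circle_base R)
  i (circle_base R)).
Qed.

Lemma petal_surj (w : bouquet R m) : exists j p, w = petal j p.
Proof.
have : [set: bouquet R m] w by [].
by rewrite -wedgeTE => -[j _ [p _ <-]]; exists j, p.
Qed.

Definition petal_proj (j : 'I_m) : bouquet R m -> circle R :=
  @wedge_fun _ _ (fun _ : 'I_m => circle_base R) _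
    (fun i p => if i == j then p else circle_base R).

Lemma petal_projE i j p :
  petal_proj j (petal i p) = if i == j then p else circle_base R.
Proof.
by rewrite /petal_proj /petal wedge_lift_funE // => k l; rewrite !if_same.
Qed.

Lemma continuous_petal_proj j : continuous (petal_proj j).
Proof.
apply: wedge_fun_continuous => [i|i k]; last by rewrite !if_same.
case: eqP => _ x; [exact: cvg_id|exact: cst_continuous].
Qed.

(** A product with a quotient need not be a quotient, but the petals form a
    finite closed cover of the bouquet by retracts, and this cover persists in
    the product. *)
Lemma continuous_bouquet_prod (T Y : topologicalType)
    (H : bouquet R m * T -> Y) :
  (forall j, continuous (fun q : circle R * T => H (petal j q.1, q.2))) ->
  continuous H.
Proof.
move=> cH; apply: (@paste_continuous 'I_m (bouquet R m * T)%type Y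
  (fun j => \bigcap_(i in [set i | i != j])
     [set q | (\val (petal_proj i q.1)).1 - 1 = 0])
  (fun j q => H (petal j (petal_proj j q.1), q.2))).
- move=> j; apply: closed_bigI => i _; apply: closed_eq0.
  apply: continuous_sub; last exact: cst_continuous.
  apply: continuous_after; first exact: continuous_fst.
  apply: continuous_after; first exact: continuous_set_val.
  apply: continuous_after; first exact: continuous_petal_proj.
  exact: continuous_fst.
- move=> [w t]; have [j [p ->]] := petal_surj w; exists j => i /= ij.
  by rewrite petal_projE eq_sym (negbTE ij) /= subrr.
- move=> j.
  apply: (@continuous_after _ _ _ (fun q : circle R * T => H (petal j q.1, q.2))
    (fun q => (petal_proj j q.1, q.2))) => //.
  apply: continuous_pair; last exact: continuous_snd.
  apply: continuous_after; first exact: continuous_petal_proj.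
  exact: continuous_fst.
- move=> j [w t] /=; have [i [p ->]] := petal_surj w => Cj.
  rewrite petal_projE; case: eqVneq => [-> //|ij].
  have := Cj i ij; rewrite /= petal_projE eqxx => /subr0_eq /circle_baseP ->.
  by rewrite (petal_base i j).
Qed.

End Bouquet.

Lemma bouquet1_circle : line_equivalent R (bouquet R 1) (circle R).
Proof.
exists (petal_proj ord0), (petal ord0); split.
- exact: continuous_petal_proj.
- exact: continuous_petal.
- apply: line_homotopic_eq => [x|w]; first exact: cvg_id.
  have [j [p ->]] := petal_surj w.
  by rewrite /= petal_projE (ord1 j) eqxx.
- apply: line_homotopic_eq => [x|p]; first exact: cvg_id.
  by rewrite /= petal_projE eqxx.
Qed.

End Circle.

(** * Collapsing triangles through free edges *)

Section Simplex.
Context (R : realType) (n : nat).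
Implicit Types (x y : 'rV[R]_n) (s : {set 'I_n}).

Definition simplex s : set 'rV[R]_n :=
  [set x | [/\ forall v, 0 <= x ord0 v, \sum_v x ord0 v = 1
             & forall v, v \notin s -> x ord0 v = 0]].

Lemma simplexS s s' x : s \subset s' -> simplex s x -> simplex s' x.
Proof.
move=> /fintype.subsetP ss [x0 x1 xs]; split=> // v vs'; apply: xs.
by apply: contra vs'; exact: ss.
Qed.

Lemma simplex_convex s x y (t : R) : 0 <= t <= 1 ->
  simplex s x -> simplex s y -> simplex s ((1 - t) *: x + t *: y).
Proof.
move=> /andP[t0 t1] [x0 x1 xs] [y0 y1 ys]; split.
- move=> v; rewrite !mxE addr_ge0 // mulr_ge0 //; lra.
- under eq_bigr do rewrite !mxE.
  by rewrite big_split /= -!big_distrr /= x1 y1; lra.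
- by move=> v vs; rewrite !mxE xs // ys // !mulr0 addr0.
Qed.

Lemma barycentric_generated (F : set {set 'I_n}) x :
  barycentric_points R (generated_complex F) x <->
  exists2 s, F s & simplex s x.
Proof.
split.
  case=> x0 x1 [_ [s Fs /fintype.subsetP xs]]; exists s => //; split=> // v.
  by apply: contraNeq => xv; apply: xs; rewrite inE.
case=> s Fs [x0 x1 xs]; split=> //; split.
  apply/eqP => /setP supp0; move: x1; rewrite big1; last first.
    by move=> v _; have := supp0 v; rewrite !inE => /negbFE/eqP.
  by move/eqP; rewrite eq_sym oner_eq0.
exists s => //; apply/fintype.subsetP => v; rewrite inE.
by apply: contraNT => /xs ->; rewrite eqxx.
Qed.

Lemma generated_complexS (F G : set {set 'I_n}) :
  (forall s, F s -> exists2 s', G s' & s \subset s') ->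
  generated_complex F `<=` generated_complex G.
Proof.
move=> FG s [s0 [f Ff sf]]; split=> //; have [g Gg fg] := FG f Ff.
by exists g => //; exact: fintype.subset_trans sf fg.
Qed.

Lemma generated_complex_eq (F G : set {set 'I_n}) :
  (forall s, F s -> exists2 s', G s' & s \subset s') ->
  (forall s, G s -> exists2 s', F s' & s \subset s') ->
  generated_complex F = generated_complex G.
Proof. by move=> FG GF; apply/seteqP; split; exact: generated_complexS. Qed.

End Simplex.

Definition restrict_codomain (X Y : Type) (B : set Y) (f : X -> Y)
  (fB : forall x, B (f x)) : X -> B := fun x => exist _ (f x) (mem_set (fB x)).

Lemma continuous_coord (R : realType) (X : topologicalType) (n : nat)
    (f : X -> 'rV[R]_n) (v : 'I_n) :
  continuous f -> continuous (fun x => f x ord0 v).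
Proof.
move=> cf.
exact: (@continuous_after _ _ _ (fun M : 'rV[R]_n => M ord0 v) f
          (@coord_continuous _ _ _ _ _)).
Qed.

Lemma continuous_segment (R : realType) (X : topologicalType) (n : nat)
    (t : X -> R) (f g : X -> 'rV[R]_n) :
  continuous t -> continuous f -> continuous g ->
  continuous (fun x => (1 - t x) *: f x + t x *: g x).
Proof.
move=> ct cf cg; apply: continuous_row => v; under eq_fun do rewrite !mxE.
apply: continuous_add; apply: continuous_mul => //; try exact: continuous_coord.
by apply: continuous_sub => //; exact: cst_continuous.
Qed.

Section Collapse.
Context (R : realType) (n : nat) (I : finType) (a b c : I -> 'I_n).
Implicit Types (x : 'rV[R]_n) (i j : I).

Definition triangle i : {set 'I_n} := [set a i; b i; c i].

Definition collapsed_edges : set {set 'I_n} :=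
  [set s | exists i, s = [set a i; c i]%SET \/ s = [set b i; c i]%SET].

Hypothesis ac : forall i, a i != c i.
Hypothesis bc : forall i, b i != c i.
Hypothesis ab : forall i, a i != b i.
Hypothesis free_edge :
  forall i j, a i \in triangle j -> b i \in triangle j -> i = j.

(** On the triangle [i], the point moves away from the free edge, along the
    direction parallel to its median, until it meets one of the two other
    edges. The formula is global because the minimum vanishes on every triangle
    that does not contain the edge. *)
Definition collapse x : 'rV[R]_n :=
  \row_v (x ord0 v + \sum_i Num.min (x ord0 (a i)) (x ord0 (b i)) *
            (2 * (v == c i)%:R - (v == a i)%:R - (v == b i)%:R)).

Lemma continuous_collapse : continuous collapse.
Proof.
have cx v : continuous (fun x => x ord0 v) by exact: coord_continuous.
apply: continuous_row => v; rewrite /collapse; under eq_fun do rewrite mxE.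
apply: continuous_add => //; apply: continuous_sumr => i.
apply: continuous_mul; last exact: cst_continuous.
exact: continuous_minr.
Qed.

Lemma min_eq0 (u v : R) : 0 <= u -> 0 <= v -> u = 0 \/ v = 0 -> Num.min u v = 0.
Proof. by move=> u0 v0 [->|->]; [rewrite min_l|rewrite min_r]. Qed.

(** Every other triangle misses an end of the free edge. *)
Lemma min_other_triangle i j x :
  simplex (triangle j) x -> i != j -> Num.min (x ord0 (a i)) (x ord0 (b i)) = 0.
Proof.
move=> [x0 _ xj] ij; apply: min_eq0 => //.
have [ai|ai] := boolP (a i \in triangle j); last by left; exact: xj.
have [bi|bi] := boolP (b i \in triangle j); last by right; exact: xj.
by rewrite (free_edge ai bi) eqxx in ij.
Qed.

Lemma collapse_triangle i x v : simplex (triangle i) x ->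
  collapse x ord0 v = x ord0 v + Num.min (x ord0 (a i)) (x ord0 (b i)) *
    (2 * (v == c i)%:R - (v == a i)%:R - (v == b i)%:R).
Proof.
move=> xi; rewrite mxE (bigD1 i) //= big1 ?addr0 // => j ji.
by rewrite (min_other_triangle xi ji) mul0r.
Qed.

Lemma sum_delta (w : 'I_n) : \sum_v (v == w)%:R = 1 :> R.
Proof.
by rewrite (bigD1 w) //= eqxx big1 ?addr0 // => v /negbTE ->.
Qed.

Lemma collapse_in_edge i x : simplex (triangle i) x ->
  simplex [set a i; c i] (collapse x) \/ simplex [set b i; c i] (collapse x).
Proof.
move=> xi; have [x0 x1 xs] := xi.
have sum1 : \sum_v collapse x ord0 v = 1.
  under eq_bigr do rewrite (collapse_triangle _ xi).
  rewrite big_split /= -big_distrr /= x1 !sumrB -big_distrr /= !sum_delta; lra.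
have [xab|/ltW xab] := lerP (x ord0 (a i)) (x ord0 (b i)); [right|left].
- split=> // v; rewrite (collapse_triangle _ xi) min_l //.
  + have [->|vc] := eqVneq v (c i).
      rewrite eq_sym (negbTE (ac i)) eq_sym (negbTE (bc i)).
      by have := x0 (c i); have := x0 (a i) => /=; lra.
    have [->|va] := eqVneq v (a i); first by rewrite (negbTE (ab i)) => /=; lra.
    have [->|vb] := eqVneq v (b i); first by move=> /=; lra.
    by have := x0 v => /=; lra.
  + rewrite !inE => /norP[/negbTE vb /negbTE vc]; rewrite vb vc.
    have [->|va] := eqVneq v (a i); first by move=> /=; lra.
    by rewrite xs; [move=> /=; lra|rewrite !inE vb vc (negbTE va)].
- split=> // v; rewrite (collapse_triangle _ xi) min_r //.
  + have [->|vc] := eqVneq v (c i).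
      rewrite eq_sym (negbTE (ac i)) eq_sym (negbTE (bc i)).
      by have := x0 (c i); have := x0 (b i) => /=; lra.
    have [->|va] := eqVneq v (a i); first by rewrite (negbTE (ab i)) => /=; lra.
    have [->|vb] := eqVneq v (b i); first by move=> /=; lra.
    by have := x0 v => /=; lra.
  + rewrite !inE => /norP[/negbTE va /negbTE vc]; rewrite va vc.
    have [->|vb] := eqVneq v (b i); first by move=> /=; lra.
    by rewrite xs; [move=> /=; lra|rewrite !inE va vc (negbTE vb)].
Qed.

Lemma collapse_id i s x :
  s = [set a i; c i]%SET \/ s = [set b i; c i]%SET -> simplex s x ->
  collapse x = x.
Proof.
move=> si xs.
have xi : simplex (triangle i) x.
  apply: simplexS xs; apply/fintype.subsetP => v.
  by case: si => ->; rewrite !inE => /orP[] ->; rewrite ?orbT.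
apply/rowP => v; rewrite (collapse_triangle _ xi).
have [x0 _ xs0] := xs.
rewrite min_eq0 ?mul0r ?addr0 //; case: si => sE; subst s; [right|left].
- by apply: xs0; rewrite !inE negb_or bc eq_sym ab.
- by apply: xs0; rewrite !inE negb_or ab ac.
Qed.

Let K := generated_complex (range triangle).
Let L := generated_complex collapsed_edges.

Lemma collapse_in_graph x :
  barycentric_points R K x -> barycentric_points R L (collapse x).
Proof.
move=> /barycentric_generated[_ [i _ <-] /collapse_in_edge xi].
by apply/barycentric_generated; case: xi => xi; [exists [set a i; c i]%SET|
  exists [set b i; c i]%SET] => //; exists i; [left|right].
Qed.

Lemma graph_in_triangles x : barycentric_points R L x -> barycentric_points R K x.
Proof.
move=> /barycentric_generated[s [i si] xs]; apply/barycentric_generated.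
exists (triangle i); first by exists i.
apply: simplexS xs; apply/fintype.subsetP => v.
by case: si => ->; rewrite !inE => /orP[] ->; rewrite ?orbT.
Qed.

Lemma collapse_homotopy_in (x : realization R K) (t : R) :
  barycentric_points R K
    ((1 - clamp 1 t) *: collapse (\val x) + clamp 1 t *: \val x).
Proof.
have /barycentric_generated[_ [i _ <-] xi] := set_valP x.
apply/barycentric_generated; exists (triangle i); first by exists i.
apply: simplex_convex => //; first exact: clamp_itv.
case: (collapse_in_edge xi); apply: simplexS; apply/fintype.subsetP => v;
  by rewrite !inE => /orP[] ->; rewrite ?orbT.
Qed.

(** The straight segment from a point to its image stays in the triangle that
    contains the point, and the points of the remaining edges do not move. *)
Theorem collapse_equivalent :
  line_equivalent R (realization R K) (realization R L).
Proof.
pose f : realization R K -> realization R L :=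
  restrict_codomain
    (f := fun p : realization R K => collapse (\val p))
    (fun p => collapse_in_graph (set_valP p)).
pose g : realization R L -> realization R K :=
  restrict_codomain
    (f := fun p : realization R L => \val p)
    (fun p => graph_in_triangles (set_valP p)).
have cvK : continuous (fun p : realization R K => \val p).
  exact: continuous_set_val.
have cvL : continuous (fun p : realization R L => \val p).
  exact: continuous_set_val.
exists f, g; split.
- apply: continuous_in_set; apply: continuous_after cvK.
  exact: continuous_collapse.
- exact: continuous_in_set.
- exists (restrict_codomain (fun q : realization R K * R =>
    collapse_homotopy_in q.1 q.2)); split.
  + have cx : continuous (fun q : realization R K * R => \val q.1).
      by apply: continuous_after; [exact: cvK|exact: continuous_fst].
    apply: continuous_in_set; apply: continuous_segment => //.
    * by apply: continuous_clamp; exact: continuous_snd.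
    * by apply: continuous_after cx; exact: continuous_collapse.
  + move=> x; apply: val_inj => /=; rewrite clamp_le0 // subr0 scale1r.
    by rewrite scale0r addr0.
  + move=> x; apply: val_inj => /=; rewrite clamp_id ?lexx ?ler01 // subrr.
    by rewrite scale0r scale1r add0r.
- apply: line_homotopic_eq => [x|x]; first exact: cvg_id.
  apply: val_inj => /=.
  have /barycentric_generated[s [i si] xs] := set_valP x.
  exact: collapse_id si xs.
Qed.

End Collapse.

(** * Graphs with a Hamiltonian path *)

Section HamiltonianGraph.
Context (R : realType) (n m : nat).
Context (q : 'I_n -> 'I_n) (u w : 'I_m.+1 -> 'I_n).
Implicit Types (x : 'rV[R]_n) (i j : 'I_m.+1) (v z : 'I_n) (s t : R).

Definition path_edge v z := (q z == (q v).+1 :> nat).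

Definition chord j : {set 'I_n} := [set u j; w j].

Definition graph_edges : set {set 'I_n} :=
  [set e | (exists v z, path_edge v z /\ e = [set v; z]%SET) \/
           (exists j, e = chord j)].

Hypothesis n_gt1 : (1 < n)%N.
Hypothesis q_inj : injective q.
Hypothesis uw : forall j, u j != w j.
Hypothesis chord_nonpath :
  forall j, ~~ path_edge (u j) (w j) && ~~ path_edge (w j) (u j).
Hypothesis chord_inj :
  forall i j, u i \in chord j -> w i \in chord j -> i = j.

Lemma position_surj (k : nat) : (k < n)%N -> exists v, q v = k :> nat.
Proof.
by move=> kn; have [p _ pK] := injF_bij q_inj; exists (p (Ordinal kn)); rewrite pK.
Qed.

Lemma simplex2_sum v z x : v != z -> simplex [set v; z] x ->
  x ord0 v + x ord0 z = 1.
Proof.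
move=> vz [_ <- xs]; rewrite (bigD1 v) //= (bigD1 z) 1?eq_sym //= big1 ?addr0 //.
by move=> y /andP[yv yz]; rewrite xs // !inE negb_or yv yz.
Qed.

Lemma simplex2_sum_mul v z x (c : 'I_n -> R) : v != z -> simplex [set v; z] x ->
  \sum_y c y * x ord0 y = c v * x ord0 v + c z * x ord0 z.
Proof.
move=> vz [_ _ xs]; rewrite (bigD1 v) //= (bigD1 z) 1?eq_sym //= big1 ?addr0 //.
by move=> y /andP[yv yz]; rewrite xs ?mulr0 // !inE negb_or yv yz.
Qed.

(** The Hamiltonian path parametrized by the position, in terms of hat functions,
    and stopped at its ends; [height] is its inverse. *)
Definition walk s : 'rV[R]_n :=
  \row_v Num.max 0 (1 - `|clamp (n.-1)%:R s - (q v)%:R|).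

Definition height x : R := \sum_v (q v)%:R * x ord0 v.

Lemma continuous_walk : continuous walk.
Proof.
apply: continuous_row => v; rewrite /walk; under eq_fun do rewrite mxE.
have cc (c : R) : continuous (fun _ : R => c) by move=> s; exact: cvg_cst.
apply: continuous_maxr => //; apply: continuous_sub => //.
apply: continuous_normr; apply: continuous_sub => //.
by apply: continuous_clamp => s; exact: cvg_id.
Qed.

Lemma continuous_height : continuous height.
Proof.
rewrite /height; apply: continuous_sumr => v.
by apply: continuous_mul; [exact: cst_continuous|exact: coord_continuous].
Qed.

Lemma unit_step (k : nat) s : (0 < k)%N -> 0 <= s <= k%:R ->
  exists2 i : nat, (i < k)%N & i%:R <= s <= i.+1%:R.
Proof.
elim: k => // -[|k] IHk _ /andP[s0 sk]; first by exists 0%N; rewrite ?s0.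
have [sk'|sk'] := lerP s k.+1%:R; last by exists k.+1; rewrite ?(ltW sk').
by have [|i ik si] := IHk isT; [rewrite s0|exists i => //; exact: ltnW].
Qed.

Lemma path_edge_neq v z : path_edge v z -> v != z.
Proof. by apply: contraTneq => ->; rewrite /path_edge; lia. Qed.

Lemma position_far (k : nat) y : q y != k :> nat -> q y != k.+1 :> nat ->
  (q y)%:R <= k%:R - 1 :> R \/ k%:R + 2 <= (q y)%:R :> R.
Proof.
move=> yk yk1; have [lt|le] := ltnP (q y) k; [left|right].
  by rewrite lerBrDr natr1 ler_nat.
by rewrite -natrD ler_nat; lia.
Qed.

Lemma walk_simplex s : exists v z, path_edge v z /\ simplex [set v; z] (walk s).
Proof.
have N0 : 0 <= (n.-1)%:R :> R by [].
have /unit_step := clamp_itv s N0; rewrite -subn1 subn_gt0 => /(_ n_gt1).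
set c := clamp _ s => -[k kn /andP[kc ck]]; rewrite -natr1 in ck.
have [v vk] : exists v, q v = k :> nat by apply: position_surj; lia.
have [z zk] : exists z, q z = k.+1 :> nat by apply: position_surj; lia.
have vz : path_edge v z by rewrite /path_edge vk zk.
exists v, z; split=> //.
have walkE y : walk s ord0 y = Num.max 0 (1 - `|c - (q y)%:R|).
  by rewrite mxE /c subn1.
have far y : y \notin [set v; z]%SET -> walk s ord0 y = 0.
  rewrite !inE negb_or walkE => /andP[yv yz]; apply/max_idPl.
  have [||yk|yk] := @position_far k y.
  - by rewrite -vk; apply: contra yv => /eqP/ord_inj/q_inj ->.
  - by rewrite -zk; apply: contra yz => /eqP/ord_inj/q_inj ->.
  - by rewrite ger0_norm; lra.
  - by rewrite ler0_norm; lra.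
split=> //; first by move=> y; rewrite walkE le_max lexx.
rewrite (bigD1 v) //= (bigD1 z) 1?eq_sym ?path_edge_neq //= big1; last first.
  by move=> y /andP[yv yz]; rewrite far // !inE negb_or yv yz.
rewrite !walkE vk zk -natr1 ger0_norm; last by lra.
by rewrite ler0_norm; [rewrite !max_r; lra|lra].
Qed.

Lemma walk_height v z x :
  path_edge v z -> simplex [set v; z] x -> walk (height x) = x.
Proof.
move=> vz xs; have vz' := path_edge_neq vz; have [x0 _ x_off] := xs.
have x1 := simplex2_sum vz' xs.
have zE : (q z)%:R = (q v)%:R + 1 :> R by rewrite (eqP vz) natr1.
have hE : height x = (q v)%:R + x ord0 z.
  rewrite /height (simplex2_sum_mul _ vz' xs) zE.
  have -> : x ord0 v = 1 - x ord0 z by lra.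
  by ring.
have xv := x0 v; have xz := x0 z.
have zn : (q z)%:R <= (n.-1)%:R :> R by rewrite ler_nat; have := ltn_ord (q z); lia.
have v0 : 0 <= (q v)%:R :> R by [].
apply/rowP => y; rewrite mxE clamp_id hE; last by lra.
have [->|yv] := eqVneq y v.
  by rewrite ger0_norm; [rewrite max_r; lra|lra].
have [->|yz] := eqVneq y z.
  by rewrite ler0_norm; [rewrite max_r; lra|lra].
rewrite (x_off y) ?inE ?negb_or ?yv ?yz //; apply/max_idPl.
have [||yk|yk] := @position_far (q v) y.
- by apply: contra yv => /eqP/ord_inj/q_inj ->.
- by rewrite -(eqP vz); apply: contra yz => /eqP/ord_inj/q_inj ->.
- by rewrite ger0_norm; lra.
- by rewrite ler0_norm; lra.
Qed.

Lemma vertex_on_path v : exists y z, path_edge y z /\ v \in [set y; z]%SET.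
Proof.
have vn := ltn_ord (q v).
have [v_lt|v_ge] := ltnP (q v).+1 n.
  have [z zv] := position_surj v_lt.
  by exists v, z; rewrite /path_edge zv eqxx !inE eqxx.
have [|y yv] := @position_surj (q v).-1; first by lia.
by exists y, v; rewrite /path_edge yv !inE eqxx orbT; split=> //; lia.
Qed.

Lemma walk_vertex v : walk (q v)%:R = delta_mx ord0 v.
Proof.
have [y [z [yz vyz]]] := vertex_on_path v.
have dv : simplex [set v] (delta_mx ord0 v : 'rV[R]_n).
  split=> [y'||y']; rewrite ?mxE ?ler0n //.
    by under eq_bigr do rewrite mxE eqxx; exact: sum_delta.
  by rewrite inE => /negbTE ->; rewrite andbF.
have <- : height (delta_mx ord0 v) = (q v)%:R.
  rewrite /height (bigD1 v) //= !mxE !eqxx mulr1 big1 ?addr0 // => y' /negbTE y'v.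
  by rewrite mxE y'v mulr0.
by apply: (walk_height yz); apply: simplexS dv; rewrite finset.sub1set.
Qed.

(** The chord, with end points at parameters 1 and -1, continued from both ends
    along the Hamiltonian path down to its origin, which is reached at 2 and
    -2. *)
Definition tour j s : 'rV[R]_n :=
  if s <= 1 then
    if -1 <= s then
      ((1 + s) / 2) *: delta_mx ord0 (u j) + ((1 - s) / 2) *: delta_mx ord0 (w j)
    else walk ((q (w j))%:R * (2 + s))
  else walk ((q (u j))%:R * (2 - s)).

Lemma tour_ge1 j s : 1 <= s -> tour j s = walk ((q (u j))%:R * (2 - s)).
Proof.
rewrite /tour; case: ifPn => // s1 s1'; have -> : s = 1 by lra.
rewrite ifT; last by lra.
rewrite subrr mul0r scale0r addr0.
have -> : (1 + 1) / 2 = 1 :> R by lra.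
have -> : 2 - 1 = 1 :> R by lra.
by rewrite scale1r mulr1 walk_vertex.
Qed.

Lemma tour_leN1 j s : s <= -1 -> tour j s = walk ((q (w j))%:R * (2 + s)).
Proof.
move=> s1; rewrite /tour ifT; last by lra.
case: ifPn => // s1'; have -> : s = -1 by lra.
rewrite subrr mul0r scale0r add0r opprK.
have -> : (1 + 1) / 2 = 1 :> R by lra.
have -> : 2 - 1 = 1 :> R by lra.
by rewrite scale1r mulr1 walk_vertex.
Qed.

Lemma tour_chord j s : -1 <= s <= 1 -> tour j s =
  ((1 + s) / 2) *: delta_mx ord0 (u j) + ((1 - s) / 2) *: delta_mx ord0 (w j).
Proof. by move=> /andP[s1 s1']; rewrite /tour s1 s1'. Qed.

Lemma tour_origin j s : 2 <= `|s| -> tour j s = walk 0.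
Proof.
have walk_le0 r : r <= 0 -> walk r = walk 0.
  by move=> r0; apply/rowP => v; rewrite !mxE !clamp_le0.
have [s0|s0] := lerP 0 s; rewrite ?(ger0_norm s0) ?(ltr0_norm s0) => s2.
  rewrite tour_ge1; last by lra.
  by apply: walk_le0; rewrite mulr_ge0_le0 //; lra.
rewrite tour_leN1; last by lra.
by apply: walk_le0; rewrite mulr_ge0_le0 //; lra.
Qed.

Lemma continuous_tour j : continuous (tour j).
Proof.
have cid : continuous (fun s : R => s) by move=> s; exact: cvg_id.
have cc (c : R) : continuous (fun _ : R => c) by move=> s; exact: cvg_cst.
have c1D : continuous (fun s : R => 1 + s) by exact: continuous_add.
have c1B : continuous (fun s : R => 1 - s) by exact: continuous_sub.
pose ray v (f : R -> R) s := walk ((q v)%:R * (1 + f s)).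
have cray v f : continuous f -> continuous (ray v f).
  move=> cf; apply: continuous_after; first exact: continuous_walk.
  by apply: continuous_mul => //; exact: continuous_add.
pose mid s : 'rV[R]_n :=
  ((1 + s) / 2) *: delta_mx ord0 (u j) + ((1 - s) / 2) *: delta_mx ord0 (w j).
have cmid : continuous mid.
  apply: continuous_row => v; rewrite /mid; under eq_fun do rewrite !mxE.
  by apply: continuous_add; apply: continuous_mul => //; exact: continuous_mul.
apply: (@paste_continuous (option bool) R 'rV[R]_n
  (fun a => [set s | 0 <= match a with
     | Some true => s - 1 | Some false => -1 - s | None => 1 - s ^+ 2 end])
  (fun a => match a with
     | Some true => ray (u j) (fun s => 1 - s)
     | Some false => ray (w j) (fun s => 1 + s)
     | None => mid end)).
- case=> [[]|]; apply: closed_ge0.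
  + exact: continuous_sub.
  + exact: continuous_sub.
  + by apply: continuous_sub => //; under eq_fun do rewrite expr2;
      exact: continuous_mul.
- move=> s; have [s1|s1] := lerP 1 s; first by exists (Some true); rewrite /=; lra.
  have [s1'|s1'] := lerP s (-1); first by exists (Some false); rewrite /=; lra.
  by exists None; rewrite /=; nra.
- by case=> [[]|] //; exact: cray.
- case=> [[]|] s /= s1.
  + by rewrite tour_ge1; [rewrite /ray addrA|lra].
  + by rewrite tour_leN1; [rewrite /ray addrA|lra].
  + by rewrite tour_chord //; nra.
Qed.

Lemma tour_chord_simplex j s : -1 <= s <= 1 ->
  simplex (chord j) (tour j s) /\ tour j s ord0 (u j) - tour j s ord0 (w j) = s.
Proof.
move=> s1; rewrite tour_chord //; split; last first.
  rewrite !mxE !eqxx /= (negbTE (uw j)) eq_sym (negbTE (uw j)) /=; lra.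
split=> [v||v]; rewrite ?mxE.
- by rewrite addr_ge0 // mulr_ge0 ?ler0n //; lra.
- under eq_bigr do rewrite !mxE eqxx /=.
  by rewrite big_split /= -!big_distrr /= !sum_delta; lra.
- rewrite !inE negb_or => /andP[/negbTE -> /negbTE ->].
  by rewrite andbF !mulr0 addr0.
Qed.

Let G := generated_complex graph_edges.

Lemma walk_in_graph s : barycentric_points R G (walk s).
Proof.
have [v [z [vz ws]]] := walk_simplex s.
by apply/barycentric_generated; exists [set v; z]%SET => //; left; exists v, z.
Qed.

Lemma tour_in_graph j s : barycentric_points R G (tour j s).
Proof.
have [s1|s1] := boolP (-1 <= s <= 1).
  apply/barycentric_generated; exists (chord j); first by right; exists j.
  by have [] := tour_chord_simplex j s1.
rewrite /tour; case: ifPn => s1'; last exact: walk_in_graph.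
by rewrite ifF; [exact: walk_in_graph|move: s1; rewrite s1' andbT => /negbTE].
Qed.

(** Functions defined separately on the chords and on the path; at a vertex the
    value is taken from the path. *)
Definition piecewise (Y : Type) x (A : 'I_m.+1 -> Y) (B : Y) : Y :=
  if [pick j | (0 < x ord0 (u j)) && (0 < x ord0 (w j))] is Some j then A j
  else B.

Lemma piecewise_path (Y : Type) v z x (A : 'I_m.+1 -> Y) (B : Y) :
  path_edge v z -> simplex [set v; z] x -> piecewise x A B = B.
Proof.
move=> vz [_ _ xs]; rewrite /piecewise; case: pickP => // j /andP[xu xw].
have in_vz y : 0 < x ord0 y -> y \in [set v; z]%SET.
  by move=> xy; apply: contraLR xy => /xs ->; rewrite ltxx.
move: (in_vz _ xu) (in_vz _ xw) (uw j) (chord_nonpath j).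
by rewrite !inE => /orP[]/eqP-> /orP[]/eqP ->; rewrite ?eqxx // vz ?andbF.
Qed.

(** A chord is determined by its end points, hence no other chord can claim a
    point in its interior. *)
Lemma piecewise_chord (Y : Type) j x (A : 'I_m.+1 -> Y) (B : Y) :
  simplex (chord j) x ->
  (x ord0 (u j) = 0 \/ x ord0 (w j) = 0 -> A j = B) -> piecewise x A B = A j.
Proof.
move=> [x0 _ xs] AB; rewrite /piecewise; case: pickP => [i /andP[xu xw]|no].
  have in_j y : 0 < x ord0 y -> y \in chord j.
    by move=> xy; apply: contraLR xy => /xs ->; rewrite ltxx.
  by congr A; apply: chord_inj; exact: in_j.
have := no j; rewrite !lt0r !x0 !andbT => /negbT; rewrite negb_and !negbK.
by move=> /orP x_uw; rewrite AB //; case: x_uw => /eqP; [left|right].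
Qed.

(** A graph is the finite union of its closed edges, so that only the agreement
    at the ends of the chords matters. *)
Lemma continuous_piecewise (X Y : topologicalType) (xi : X -> 'rV[R]_n)
    (A : 'I_m.+1 -> X -> Y) (B : X -> Y) :
  continuous xi -> (forall p, barycentric_points R G (xi p)) ->
  (forall j, continuous (A j)) -> continuous B ->
  (forall j p, simplex (chord j) (xi p) ->
     xi p ord0 (u j) = 0 \/ xi p ord0 (w j) = 0 -> A j p = B p) ->
  continuous (fun p => piecewise (xi p) (A^~ p) (B p)).
Proof.
move=> cxi xiG cA cB AB.
pose off (s : {set 'I_n}) := [set p | forall v, v \notin s -> xi p ord0 v = 0].
have off_simplex (e : {set 'I_n}) p : off e p -> simplex e (xi p).
  by have [x0 x1 _] := xiG p; split.
have closed_off (e : {set 'I_n}) : closed (off e).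
  have -> : off e = \bigcap_(v in [set v | v \notin e])
                      [set p | xi p ord0 v = 0].
    by apply/seteqP; split.
  by apply: closed_bigI => v _; apply: closed_eq0; exact: continuous_coord.
apply: (@paste_continuous ('I_m.+1 + 'I_n * 'I_n)%type _ _
  (fun a => match a with
            | inl j => off (chord j)
            | inr (v, z) => if path_edge v z then off [set v; z]%SET else set0
            end)
  (fun a => if a is inl j then A j else B)).
- case=> [j|[v z]]; first exact: closed_off.
  by case: ifP => _; [exact: closed_off|exact: closed0].
- move=> p; have /barycentric_generated[s Gs [_ _ ps]] := xiG p.
  case: Gs => [[v [z [vz sE]]]|[j sE]]; subst s.
    by exists (inr (v, z)); rewrite vz.
  by exists (inl j).
- by case.
- case=> [j|[v z]] p.
    by move=> /off_simplex pj; rewrite (piecewise_chord pj) //; exact: AB.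
  by case: ifP => // vz /off_simplex; exact: piecewise_path.
Qed.

Lemma chord_coords j x : simplex (chord j) x ->
  x = tour j (x ord0 (u j) - x ord0 (w j)).
Proof.
move=> xs; have [x0 _ x_off] := xs; have x1 := simplex2_sum (uw j) xs.
have xu := x0 (u j); have xw := x0 (w j).
rewrite tour_chord; last by lra.
apply/rowP => v; rewrite !mxE eqxx /=.
have [->|vu] := eqVneq v (u j); first by rewrite (negbTE (uw j)) /=; lra.
have [->|vw] := eqVneq v (w j); first by rewrite /=; lra.
by rewrite (x_off v) ?inE ?negb_or ?vu ?vw //=; lra.
Qed.

Lemma chord_vertex j x : simplex (chord j) x ->
  x ord0 (u j) = 0 \/ x ord0 (w j) = 0 ->
  x ord0 (u j) - x ord0 (w j) = 1 /\ height x = (q (u j))%:R \/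
  x ord0 (u j) - x ord0 (w j) = -1 /\ height x = (q (w j))%:R.
Proof.
move=> xs x0; have x1 := simplex2_sum (uw j) xs.
rewrite /height (simplex2_sum_mul _ (uw j) xs).
case: x0 => x0; move: x1; rewrite x0 ?add0r ?addr0 => ->; [right|left];
  by split; ring.
Qed.

Lemma tour_vertex j x t : 0 <= t <= 1 -> simplex (chord j) x ->
  x ord0 (u j) = 0 \/ x ord0 (w j) = 0 ->
  tour j ((2 - t) * (x ord0 (u j) - x ord0 (w j))) = walk (t * height x).
Proof.
move=> t01 xs /(chord_vertex xs)[] [-> ->].
  by rewrite mulr1 tour_ge1; [congr walk; ring|lra].
by rewrite mulrN1 tour_leN1; [congr walk; ring|lra].
Qed.

(** Pinching the path to the base point closes each chord into a petal. The
    difference of the two coordinates runs over [-1, 1] along the chord, and the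
    factor 2 makes it a full turn. *)
Definition pinch x : bouquet R m.+1 :=
  piecewise x
    (fun j => petal j (wind (2 * (x ord0 (u j) - x ord0 (w j)))))
    (petal ord0 (circle_base R)).

Lemma pinch_chord j x : simplex (chord j) x ->
  pinch x = petal j (wind (2 * (x ord0 (u j) - x ord0 (w j)))).
Proof.
move=> xs; rewrite /pinch (piecewise_chord xs) // => /(chord_vertex xs).
move=> x_uw; rewrite (petal_base R ord0 j) wind_base //.
by case: x_uw => -[-> _]; rewrite ?mulrN1 ?mulr1 ?normrN ger0_norm.
Qed.

(** A tour spends its outer halves on the path, and its chord at double speed
    is the whole petal. *)
Lemma pinch_tour j s : pinch (tour j s) = petal j (wind (2 * s)).
Proof.
have [s1|s1] := boolP (-1 <= s <= 1).
  by have [xs sE] := tour_chord_simplex j s1; rewrite (pinch_chord xs) sE.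
have walkE r : pinch (walk r) = petal j (circle_base R).
  have [v [z [vz ws]]] := walk_simplex r.
  by rewrite /pinch (piecewise_path _ _ vz ws) (petal_base R ord0 j).
rewrite wind_base; last first.
  rewrite normrM ger0_norm // ler_peMr //; move: s1; rewrite -ler_norml -ltNge.
  exact: ltW.
rewrite /tour; case: ifPn => s1'; last exact: walkE.
by rewrite ifF; [exact: walkE|move: s1; rewrite s1' andbT => /negbTE].
Qed.

Lemma continuous_pinch :
  continuous (fun p : realization R G => pinch (\val p)).
Proof.
have cv : continuous (fun p : realization R G => \val p).
  exact: continuous_set_val.
apply: continuous_piecewise => //.
- by move=> p; exact: set_valP.
- move=> j; apply: continuous_after; first exact: continuous_petal.
  apply: continuous_after; first exact: continuous_wind.
  apply: continuous_mul; first exact: cst_continuous.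
  by apply: continuous_sub; exact: continuous_coord.
- exact: cst_continuous.
- move=> j p ps /(chord_vertex ps) x_uw; rewrite (petal_base R ord0 j) wind_base //.
  by case: x_uw => -[-> _]; rewrite ?mulrN1 ?mulr1 ?normrN ger0_norm.
Qed.

Lemma unwind_base : unwind (circle_base R) = 2.
Proof. by rewrite /unwind /= lexx. Qed.

Definition loops : bouquet R m.+1 -> 'rV[R]_n :=
  @wedge_fun _ _ (fun _ : 'I_m.+1 => circle_base R) _
    (fun j p => tour j (unwind p)).

Lemma loops_agree i j :
  tour i (unwind (circle_base R)) = tour j (unwind (circle_base R)).
Proof. by rewrite unwind_base !tour_origin // ger0_norm. Qed.

Lemma loops_petal j p : loops (petal j p) = tour j (unwind p).
Proof. by rewrite /loops /petal wedge_lift_funE //; exact: loops_agree. Qed.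

Lemma continuous_loops : continuous loops.
Proof.
apply: wedge_fun_continuous => [j|]; last exact: loops_agree.
apply: (@continuous_unwind R _ _ id (fun sp => tour j sp.1)) => //.
- by move=> p; exact: cvg_id.
- by apply: continuous_after; [exact: continuous_tour|exact: continuous_fst].
- by move=> p /=; rewrite !tour_origin ?normrN ?ger0_norm.
Qed.

Lemma loops_in_graph b : barycentric_points R G (loops b).
Proof.
by have [j [p ->]] := petal_surj b; rewrite loops_petal; exact: tour_in_graph.
Qed.

(** The path is contracted to its origin while the chords are stretched along
    their tours, to follow their end points. Time runs backwards: the path is
    collapsed at time 0 and the identity is reached at time 1. *)
Definition retreat x t : 'rV[R]_n :=
  piecewise x
    (fun j => tour j ((2 - clamp 1 t) * (x ord0 (u j) - x ord0 (w j))))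
    (walk (clamp 1 t * height x)).

Lemma retreat_in_graph x t : barycentric_points R G (retreat x t).
Proof.
by rewrite /retreat /piecewise; case: pickP => *; [exact: tour_in_graph|
  exact: walk_in_graph].
Qed.

Lemma continuous_retreat :
  continuous (fun pt : realization R G * R => retreat (\val pt.1) pt.2).
Proof.
have cv : continuous (fun pt : realization R G * R => \val pt.1).
  by apply: continuous_after; [exact: continuous_set_val|exact: continuous_fst].
have ct : continuous (fun pt : realization R G * R => clamp 1 pt.2).
  by apply: continuous_clamp; exact: continuous_snd.
apply: (@continuous_piecewise _ _ (fun pt : realization R G * R => \val pt.1)
  (fun j pt => tour j ((2 - clamp 1 pt.2) *
     (\val pt.1 ord0 (u j) - \val pt.1 ord0 (w j))))
  (fun pt => walk (clamp 1 pt.2 * height (\val pt.1)))) => //.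
- by move=> pt; exact: set_valP.
- move=> j; apply: continuous_after; first exact: continuous_tour.
  apply: continuous_mul; apply: continuous_sub => //; try exact: continuous_coord.
  exact: cst_continuous.
- apply: continuous_after; first exact: continuous_walk.
  apply: continuous_mul => //; apply: continuous_after cv.
  exact: continuous_height.
- by move=> j pt ps; apply: tour_vertex => //; exact: clamp_itv.
Qed.

Lemma retreat0 (p : realization R G) : retreat (\val p) 0 = loops (pinch (\val p)).
Proof.
rewrite /retreat /pinch /piecewise clamp_le0 // subr0 mul0r.
case: pickP => [j /andP[xu xw]|_]; rewrite loops_petal.
  rewrite windK //; have [x0 x1 _] := set_valP p.
  have : \val p ord0 (u j) + \val p ord0 (w j) <= 1.
    rewrite -x1 (bigD1 (u j)) //= (bigD1 (w j)) 1?eq_sym ?uw //= lerD2l lerDl.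
    exact: sumr_ge0.
  by rewrite ltr_norml => x_le; apply/andP; split; lra.
by rewrite unwind_base tour_origin // ger0_norm.
Qed.

Lemma retreat1 (p : realization R G) : retreat (\val p) 1 = \val p.
Proof.
rewrite /retreat clamp_id ?ler01 ?lexx //.
have /barycentric_generated[s Gs ps] := set_valP p.
case: Gs => [[v [z [vz sE]]]|[j sE]]; subst s.
  by rewrite (piecewise_path _ _ vz ps) mul1r (walk_height vz ps).
rewrite (piecewise_chord ps) => [|x_uw].
  have -> : 2 - 1 = 1 :> R by ring.
  by rewrite mul1r -chord_coords.
by apply: tour_vertex => //; rewrite ler01 lexx.
Qed.

(** On a petal, the composite of the two maps doubles the speed and stops at the
    base point; the speed is brought back from 2 to 1. *)
Definition unroll (bt : bouquet R m.+1 * R) : bouquet R m.+1 :=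
  @wedge_fun _ _ (fun _ : 'I_m.+1 => circle_base R) _
    (fun j p => petal j (wind ((2 - clamp 1 bt.2) * unwind p))) bt.1.

Lemma unroll_petal j p t :
  unroll (petal j p, t) = petal j (wind ((2 - clamp 1 t) * unwind p)).
Proof.
rewrite /unroll /petal wedge_lift_funE // => i k; rewrite unwind_base.
rewrite wind_base; first exact: petal_base.
have := @clamp_itv _ 1 t ler01 => t01.
by rewrite ger0_norm; nra.
Qed.

Lemma continuous_unroll : continuous unroll.
Proof.
apply: continuous_bouquet_prod => j; under eq_fun do rewrite unroll_petal.
apply: (@continuous_unwind R _ _ (fun pt : circle R * R => pt.1)
  (fun spt => petal j (wind ((2 - clamp 1 spt.2.2) * spt.1)))).
- exact: continuous_fst.
- apply: continuous_after; first exact: continuous_petal.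
  apply: continuous_after; first exact: continuous_wind.
  apply: continuous_mul; last exact: continuous_fst.
  apply: continuous_sub; first exact: cst_continuous.
  apply: continuous_clamp; apply: continuous_after; exact: continuous_snd.
- move=> [p t] /=; have := @clamp_itv _ 1 t ler01 => t01.
  by rewrite !wind_base //; [rewrite mulrN normrN|]; rewrite ger0_norm; nra.
Qed.

Theorem hamiltonian_graph_equivalent :
  line_equivalent R (realization R G) (bouquet R m.+1).
Proof.
pose g : bouquet R m.+1 -> realization R G := restrict_codomain loops_in_graph.
exists (fun p => pinch (\val p)), g; split.
- exact: continuous_pinch.
- apply: continuous_in_set; exact: continuous_loops.
- exists (restrict_codomain (f := fun pt : realization R G * R =>
    retreat (\val pt.1) pt.2) (fun pt => retreat_in_graph _ _)); split.
  + apply: continuous_in_set; exact: continuous_retreat.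
  + by move=> p; apply: val_inj; exact: retreat0.
  + by move=> p; apply: val_inj; exact: retreat1.
- exists unroll; split.
  + exact: continuous_unroll.
  + move=> b; have [j [p ->]] := petal_surj b.
    rewrite unroll_petal clamp_le0 // subr0 /=.
    by rewrite loops_petal pinch_tour.
  + move=> b; have [j [p ->]] := petal_surj b.
    rewrite unroll_petal clamp_id ?ler01 ?lexx //.
    have -> : 2 - 1 = 1 :> R by ring.
    by rewrite mul1r unwindK.
Qed.

End HamiltonianGraph.

(** * Firing sets on the directed cycle *)

Section Cycle.
Context (n : nat).
Implicit Types (i j : 'I_n) (d t : nat).

Lemma ord_gt0 i : (0 < n)%N.
Proof. exact: leq_ltn_trans (ltn_ord i). Qed.

Definition shift d i : 'I_n := Ordinal (ltn_pmod (i + d) (ord_gt0 i)).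

Lemma shiftP d i : (d < n)%N ->
  (shift d i = i + d :> nat /\ i + d < n \/
   shift d i + n = i + d /\ n <= i + d)%N.
Proof.
move=> dn; have i_lt := ltn_ord i; rewrite /=.
have [lt|ge] := ltnP (i + d) n; first by left; rewrite modn_small.
right; split=> //; rewrite -[(i + d)%N](subnK ge) modnDr modn_small //; lia.
Qed.

Lemma ord_pred_shift d i : ord_pred (shift d.+1 i) = shift d i.
Proof.
have n0 := ord_gt0 i; apply: val_inj => /=.
rewrite -subn1 -addnBA // modnDml addnS addSn.
by rewrite -addnS subn1 prednK // modnDr.
Qed.

Lemma shift0 i : shift 0 i = i.
Proof. by apply: val_inj; rewrite /= addn0 modn_small. Qed.

Lemma shift_cancel t : cancel (shift t) (iter t (@ord_pred n)).
Proof.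
elim: t => [|t IHt] i; first by rewrite shift0.
by rewrite iterSr ord_pred_shift IHt.
Qed.

(** With at most one grain on every vertex, every grain moves at every time, so
    that a vertex inherits the grain of its predecessor. *)
Lemma iter_step (c : config n) t : (forall i, c i <= 1)%N ->
  iter t (@step n) c = [ffun i => c (iter t (@ord_pred n) i)].
Proof.
move=> c1; elim: t => [|t IHt]; first by apply/ffunP => i; rewrite ffunE.
rewrite iterS IHt; apply/ffunP => i; rewrite !ffunE !inE !ffunE -iterSr.
by move: (c1 (iter t (@ord_pred n) i)) (c1 (iter t.+1 (@ord_pred n) i));
  case: (c _) => [|[|?]] //; case: (c _) => [|[|?]].
Qed.

Definition trio k i : {set 'I_n} := [set i; shift 1 i; shift k.+2 i].

Lemma firing_init k t (v : 'I_n) : v = 0%N :> nat -> (1 < n)%N -> (k.+2 < n)%N ->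
  firing_at (init_config n k) t = trio k (shift t v).
Proof.
move=> v0 n1 kn; have n0 := ord_gt0 v.
have shift_shift d : shift d (shift t v) = shift t (shift d v).
  by apply: val_inj; rewrite /= !modnDml addnAC.
rewrite /trio !shift_shift /firing_at iter_step; last first.
  by move=> i; rewrite ffunE leq_b1.
apply/setP => i'; have [p _ pK] := injF_bij (can_inj (shift_cancel t)).
rewrite -[i']pK; move: (p i') => i.
rewrite !inE !ffunE !(inj_eq (can_inj (shift_cancel t))) shift_cancel -!val_eqE /=.
by rewrite v0 !add0n (modn_small n1) (modn_small kn) lt0b !inE orbA.
Qed.

Lemma range_firing k : (1 < n)%N -> (k.+2 < n)%N ->
  range (firing_at (init_config n k)) = range (trio k).
Proof.
move=> n1 kn; pose v : 'I_n := Ordinal (ltnW n1).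
apply/seteqP; split=> _ [t _ <-].
  by exists (shift t v) => //; rewrite (@firing_init k t v).
exists (t : nat) => //; rewrite (@firing_init k t v) //; congr trio.
by apply: val_inj; rewrite /= add0n modn_small.
Qed.

(** Inclusion of edges as a condition on numbers, ready for arithmetic. *)
Lemma pair_subset (x y x' y' : 'I_n) :
  (x = x' :> nat /\ y = y' :> nat) \/ (x = y' :> nat /\ y = x' :> nat) ->
  [set x; y]%SET \subset [set x'; y']%SET.
Proof.
move=> xy; apply/fintype.subsetP => z; rewrite !inE -!val_eqE /=.
by case: xy => -[-> ->]; rewrite // orbC.
Qed.

End Cycle.

(** * Collapses of the avalanche complex *)

Section Avalanche.
Context (R : realType) (n : nat).
Hypothesis n_gt4 : (4 < n)%N.

Definition chorded_cycle (d m : nat) : set {set 'I_n} :=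
  [set s | exists i : 'I_n, s = [set i; shift 1 i]%SET \/
             (i < m)%N /\ s = [set i; shift d i]%SET].

(** Cutting the edge that closes the cycle leaves a Hamiltonian path, and the
    cut edge becomes the chord of index 0. If [2 * d = n], then the chords from
    [i] and from [i + d] coincide, so that only the first [d] vertices may
    carry one. *)
Lemma chorded_cycle_equivalent (d m : nat) :
  (m <= n)%N -> (0 < m -> 1 < d < n.-1)%N -> ((2 * d != n) || (m <= d))%N ->
  line_equivalent R (realization R (generated_complex (chorded_cycle d m)))
    (bouquet R m.+1).
Proof.
move=> mn d_mid d_half.
have n0 : (0 < n)%N by lia.
have [u [w uw_spec]] : exists u w : 'I_m.+1 -> 'I_n, forall j : 'I_m.+1,
    (j = 0%N :> nat /\ u j = n.-1 :> nat /\ w j = 0%N :> nat) \/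
    ((u j).+1 = j :> nat /\ (u j < m)%N /\ w j = shift d (u j)).
  pose u_nat (j : nat) := (if j is j'.+1 then j' else n.-1)%N.
  have u_lt (j : 'I_m.+1) : (u_nat j < n)%N.
    by have := ltn_ord j; rewrite /u_nat; case: (j : nat) => [|j'] /=; lia.
  exists (fun j : 'I_m.+1 => Ordinal (u_lt j)).
  exists (fun j : 'I_m.+1 =>
    shift (if j == 0%N :> nat then 1%N else d) (Ordinal (u_lt j))).
  move=> j; have jm := ltn_ord j; have [j0|j0] := eqVneq (j : nat) 0%N.
    left; split=> //; split=> /=; rewrite /u_nat j0 //.
    by rewrite addn1 prednK // modnn.
  right; split; [|split=> //];
    by rewrite /= /u_nat; case: (j : nat) j0 jm.
have w_pos (j : 'I_m.+1) : (0 < j -> w j = u j + d :> nat \/ w j + n = u j + d)%N.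
  case: (uw_spec j) => -[jE [um ->]]; first by rewrite jE.
  have dn : (d < n)%N by lia.
  by have := shiftP (u j) dn; lia.
rewrite (_ : generated_complex _ = generated_complex (graph_edges id u w)).
  apply: hamiltonian_graph_equivalent => //.
  - lia.
  - move=> j; rewrite -val_eqE /=.
    by have := uw_spec j; have := w_pos j; have := ltn_ord (u j); lia.
  - move=> j; rewrite /path_edge.
    by have := uw_spec j; have := w_pos j; have := ltn_ord (u j); lia.
  - move=> i j; rewrite !inE -!val_eqE /= => ui wi; apply: ord_inj.
    have := ltn_ord (u i); have := ltn_ord (u j).
    by move: (uw_spec i) (uw_spec j) (w_pos i) (w_pos j); lia.
apply: generated_complex_eq => s.
  case=> i [->|[im ->]].
    have := @shiftP n 1 i; have i_lt := ltn_ord i.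
    have [i_last|i_last] := eqVneq (i : nat) n.-1 => i_next.
      exists (chord u w ord0); first by right; exists ord0.
      have o0 : (ord0 : 'I_m.+1) = 0%N :> nat by [].
      by apply: pair_subset; have := uw_spec ord0; lia.
    exists [set i; shift 1 i]%SET => //; left; exists i, (shift 1 i); split=> //.
    by rewrite /path_edge; lia.
  have im' : (i.+1 < m.+1)%N by [].
  exists (chord u w (Ordinal im')); first by right; exists (Ordinal im').
  case: (uw_spec (Ordinal im')) => -[//= [uE] [_ wE]]; rewrite /chord wE.
  have -> : u (Ordinal im') = i by exact: ord_inj.
  exact: fintype.subxx.
case=> [[v [z [vz ->]]]|[j ->]].
  exists [set v; shift 1 v]%SET; first by exists v; left.
  apply: pair_subset; left; split=> //; move: vz; rewrite /path_edge.
  by have := @shiftP n 1 v; have := ltn_ord z; lia.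
case: (uw_spec j) => -[jE [um wE]].
  exists [set u j; shift 1 (u j)]%SET; first by exists (u j); left.
  by apply: pair_subset; left; split=> //; have := @shiftP n 1 (u j); lia.
exists [set u j; shift d (u j)]%SET; first by exists (u j); right.
by rewrite /chord wE.
Qed.

Let avalanche k := realization R (avalanche_complex (init_config n k)).

Lemma avalanche_collapse (k : nat) (a b c : 'I_n -> 'I_n) : (k.+2 < n)%N ->
  (forall i, triangle a b c i = trio k i) ->
  (forall i, [/\ a i != c i, b i != c i & a i != b i]) ->
  (forall i j, a i \in trio k j -> b i \in trio k j -> i = j) ->
  line_equivalent R (avalanche k)
    (realization R (generated_complex (collapsed_edges a b c))).
Proof.
move=> kn abc_trio distinct free.
rewrite /avalanche /avalanche_complex range_firing //; last by lia.
have <- : triangle a b c = trio k by exact/funext.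
apply: collapse_equivalent => [i|i|i|i j]; try by case: (distinct i).
by rewrite abc_trio; exact: free.
Qed.

(** The sides of a triangle are steps of lengths 1, [k + 1] and [k + 2], up to
    sign and modulo [n]. Here the steps of length [k + 1] differ from the two
    other kinds and from their own opposites, so that each belongs to a single
    triangle, and the triangle of [i] can be pushed towards [i]. The steps of
    length [k + 2] that remain are counted twice if [2 (k + 2) = n], and are
    edges of the cycle if [k + 3 = n]. *)
Lemma avalanche_apex0 (k m : nat) : (0 < k <= n - 3)%N ->
  (2 * k + 3 != n)%N -> (2 * k.+1 != n)%N ->
  (m == n) || (2 * k.+2 == n)%N && (m == k.+2) || (k.+3 == n) && (m == 0)%N ->
  line_equivalent R (avalanche k)
    (realization R (generated_complex (chorded_cycle k.+2 m))).
Proof.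
move=> k_range k_mid k_half m_cases.
have kn : (k.+2 < n)%N by lia.
have n1 : (1 < n)%N by lia.
have <- : generated_complex (collapsed_edges (shift 1) (shift k.+2) id) =
          generated_complex (chorded_cycle k.+2 m).
  apply: generated_complex_eq => s [i /=].
    case=> ->.
      exists [set i; shift 1 i]%SET; first by exists i; left.
      by apply: pair_subset; right.
    have iP := shiftP i kn; have i_lt := ltn_ord i.
    set j := shift k.+2 i in iP *.
    have jP := shiftP j kn; have j1P := shiftP j n1.
    have [im|im] := ltnP i m.
      exists [set i; j]%SET; first by exists i; right.
      by apply: pair_subset; right.
    (* If [i] is not among the first [m] vertices, then either the other end [j]
       is, or [k.+3 = n] and the edge belongs to the cycle. *)
    have [jm|jm] := ltnP j m.
      exists [set j; shift k.+2 j]%SET; first by exists j; right.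
      by apply: pair_subset; left; split=> //; lia.
    exists [set j; shift 1 j]%SET; first by exists j; left.
    by apply: pair_subset; left; split=> //; lia.
  case=> [->|[_ ->]].
    exists [set shift 1 i; i]%SET; first by exists i; left.
    by apply: pair_subset; right.
  exists [set shift k.+2 i; i]%SET; first by exists i; right.
  by apply: pair_subset; right.
apply: avalanche_collapse => //.
- by move=> i; apply/setP => v; rewrite !inE; do 3 case: eqP.
- move=> i; have := shiftP i kn; have := shiftP i n1; have := ltn_ord i.
  by cbv beta; rewrite -!(inj_eq (@ord_inj n)) => *; split; lia.
- move=> i j; cbv beta; rewrite !inE -!(inj_eq (@ord_inj n)).
  move=> ai bi; apply: ord_inj.
  have := shiftP i kn; have := shiftP i n1; have := ltn_ord i.
  have := shiftP j kn; have := shiftP j n1; have := ltn_ord j.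
  lia.
Qed.

(** Here the free edges are the steps of length [k + 2], and the triangle of [i]
    is pushed towards [i + 1]. The steps of length [k + 1] that remain are edges
    of the cycle if [k = 0], and are counted twice if [2 (k + 1) = n]. *)
Lemma avalanche_apex1 (k m : nat) : (k.+3 < n)%N ->
  (2 * k + 3 != n)%N -> (2 * k.+2 != n)%N ->
  (k == 0)%N && (m == 0)%N || (2 * k.+1 == n)%N && (m == k.+1) ->
  line_equivalent R (avalanche k)
    (realization R (generated_complex (chorded_cycle k.+1 m))).
Proof.
move=> k_lt k_mid k_half m_cases.
have kn : (k.+2 < n)%N by lia.
have k1n : (k.+1 < n)%N by lia.
have n1 : (1 < n)%N by lia.
have <- : generated_complex (collapsed_edges id (shift k.+2) (shift 1)) =
          generated_complex (chorded_cycle k.+1 m).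
  apply: generated_complex_eq => s [i /=].
    case=> ->.
      exists [set i; shift 1 i]%SET; first by exists i; left.
      by apply: pair_subset; left.
    have iP := shiftP i kn; have i1P := shiftP i n1; have i_lt := ltn_ord i.
    set j := shift 1 i in i1P *; set v := shift k.+2 i in iP *.
    have jP := shiftP j k1n; have j1P := shiftP j n1; have vP := shiftP v k1n.
    have [k0|k0] := eqVneq k 0%N.
      exists [set j; shift 1 j]%SET; first by exists j; left.
      by apply: pair_subset; right; split=> //; lia.
    (* If [2 * k.+1 = n], then the edge is a step from both of its ends, exactly
       one of which is among the first [m] vertices. *)
    have [jm|jm] := ltnP j m.
      exists [set j; shift k.+1 j]%SET; first by exists j; right.
      by apply: pair_subset; right; split=> //; lia.
    exists [set v; shift k.+1 v]%SET; first by exists v; right; split=> //; lia.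
    by apply: pair_subset; left; split=> //; lia.
  case=> [->|[im ->]].
    exists [set i; shift 1 i]%SET; first by exists i; left.
    by apply: pair_subset; left.
  (* This edge lies in the triangle of the predecessor [j] of [i]. *)
  have iP := shiftP i k1n; have i_lt := ltn_ord i.
  set v := shift k.+1 i in iP *.
  have [j jE] : exists j : 'I_n, j = (if i == 0%N :> nat then n.-1 else i.-1) :> nat.
    have jn : ((if i == 0%N :> nat then n.-1 else i.-1) < n)%N.
      by case: ifP => *; lia.
    by exists (Ordinal jn).
  have jP := shiftP j kn; have j1P := shiftP j n1.
  exists [set shift k.+2 j; shift 1 j]%SET; first by exists j; right.
  by apply: pair_subset; right; move: jE; case: ifP => *; split; lia.
apply: avalanche_collapse => //.
- by move=> i; apply/setP => v; rewrite !inE; do 3 case: eqP.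
- move=> i; have := shiftP i kn; have := shiftP i n1; have := ltn_ord i.
  by cbv beta; rewrite -!(inj_eq (@ord_inj n)) => *; split; lia.
- move=> i j; cbv beta; rewrite !inE -!(inj_eq (@ord_inj n)).
  move=> ai bi; apply: ord_inj.
  have := shiftP i kn; have := shiftP i n1; have := ltn_ord i.
  have := shiftP j kn; have := shiftP j n1; have := ltn_ord j.
  lia.
Qed.

(** For [n = 2 k + 3], steps of lengths [k + 1] and [k + 2] are opposite, and it
    is the edges of length 1 that are free. The steps of length [k + 2] that
    remain form a single cycle: two of them amount to one step of length 1, so
    that doubling modulo [n] gives the position of a vertex along it. *)
Lemma avalanche_odd (k : nat) : (2 * k + 3 = n)%N ->
  line_equivalent R (avalanche k) (bouquet R 1).
Proof.
move=> k_mid.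
have kn : (k.+2 < n)%N by lia.
have n1 : (1 < n)%N by lia.
have n0 : (0 < n)%N by lia.
apply: (@line_equivalent_trans _ _
  (realization R (generated_complex (collapsed_edges id (shift 1) (shift k.+2))))).
  apply: avalanche_collapse => //.
  - move=> i; have := shiftP i kn; have := shiftP i n1; have := ltn_ord i.
    by cbv beta; rewrite -!(inj_eq (@ord_inj n)) => *; split; lia.
  - move=> i j; cbv beta; rewrite !inE -!(inj_eq (@ord_inj n)).
  move=> ai bi; apply: ord_inj.
    have := shiftP i kn; have := shiftP i n1; have := ltn_ord i.
    have := shiftP j kn; have := shiftP j n1; have := ltn_ord j.
    lia.
have [q qP] : exists q : 'I_n -> 'I_n,
    forall i, (q i = i + i :> nat \/ q i + n = i + i)%N.
  exists (fun i : 'I_n => shift i i) => i.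
  by case: (@shiftP n i i (ltn_ord i)) => -[]; [left|right].
pose last : 'I_n := Ordinal (ltnW kn); pose first : 'I_n := Ordinal n0.
have lastE : last = k.+1 :> nat by [].
have firstE : first = 0%N :> nat by [].
rewrite (_ : generated_complex _ = generated_complex
  (graph_edges q (fun _ : 'I_1 => last) (fun _ : 'I_1 => first))).
  apply: hamiltonian_graph_equivalent => //.
  - by move=> i j /(congr1 (@nat_of_ord n)) => qij; apply: ord_inj;
      move: (qP i) (qP j) (ltn_ord i) (ltn_ord j) (ltn_ord (q i)); lia.
  - by move=> _; rewrite /path_edge; have := qP last; have := qP first;
      have := ltn_ord (q last); have := ltn_ord (q first); lia.
  - by move=> i j _ _; rewrite (ord1 i) (ord1 j).
apply: generated_complex_eq => s.
  have edge_covered (i : 'I_n) : exists2 s', graph_edges q (fun _ : 'I_1 => last)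
      (fun _ : 'I_1 => first) s' & [set i; shift k.+2 i]%SET \subset s'.
    have iP := shiftP i kn; have i_lt := ltn_ord i.
    have [il|il] := eqVneq (i : nat) k.+1.
      exists [set last; first]%SET; first by right; exists ord0.
      by apply: pair_subset; left; split; lia.
    exists [set i; shift k.+2 i]%SET => //; left; exists i, (shift k.+2 i).
    split=> //; rewrite /path_edge.
    have := qP i; have := qP (shift k.+2 i).
    by have := ltn_ord (q i); have := ltn_ord (q (shift k.+2 i)); lia.
  case=> i /= [] ->; first exact: edge_covered.
  have iP := shiftP i kn; have i1P := shiftP i n1; have i_lt := ltn_ord i.
  have [s' s'E sub] := edge_covered (shift k.+2 i); exists s' => //.
  apply: fintype.subset_trans sub; apply: pair_subset; right; split=> //.
  by have := shiftP (shift k.+2 i) kn; lia.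
have edge_covered (i v : 'I_n) : (i + k.+2 = v \/ i + k.+2 = v + n)%N ->
    exists2 s', collapsed_edges id (shift 1) (shift k.+2) s' &
      [set i; v]%SET \subset s'.
  move=> iv; exists [set i; shift k.+2 i]%SET; first by exists i; left.
  apply: pair_subset; left; split=> //.
  by have := shiftP i kn; have := ltn_ord v; have := ltn_ord i; lia.
case=> [[v [z [vz ->]]]|[j ->]]; last by apply: edge_covered; lia.
apply: edge_covered.
move: vz; rewrite /path_edge; have := qP v; have := qP z.
by have := ltn_ord v; have := ltn_ord z; have := ltn_ord (q z); lia.
Qed.

End Avalanche.

Theorem proposition3p23 (R : realType) (n k : nat) (n_gt4 : (4 < n)%N)
    (k_le : (k <= n - 3)%N) :
  let A := realization R (avalanche_complex (init_config n k)) in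
  if (k == 0) || (k == n - 3)%N then
    homotopy_equivalent R A (circle R)
  else if odd n && (k == (n - 3)./2)%N then
    homotopy_equivalent R A (circle R)
  else if ~~ odd n && ((k == n./2 - 2) || (k == n./2 - 1))%N then
    homotopy_equivalent R A (bouquet R (n./2 + 1))
  else
    homotopy_equivalent R A (bouquet R (n + 1)).
Proof.
move=> A.
have to_circle : line_equivalent R A (bouquet R 1) ->
    homotopy_equivalent R A (circle R).
  move=> A1; apply: line_equivalentW.
  by apply: line_equivalent_trans A1 _; exact: bouquet1_circle.
case: ifPn => [k_end|/norP[k0 k_last]].
  apply: to_circle; have [k0|k0] := eqVneq k 0%N.
    apply: (line_equivalent_trans (@avalanche_apex1 R n n_gt4 k 0 _ _ _ _));
      try lia.
    by apply: chorded_cycle_equivalent; lia.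
  apply: (line_equivalent_trans (@avalanche_apex0 R n n_gt4 k 0 _ _ _ _));
      try lia.
  by apply: chorded_cycle_equivalent; lia.
case: ifPn => [k_odd|k_nodd].
  by apply: to_circle; apply: avalanche_odd; lia.
case: ifPn => [k_even|k_neven]; apply: line_equivalentW; rewrite addn1.
  have [kE|kE] := eqVneq k (n./2 - 2)%N.
    apply: (line_equivalent_trans (@avalanche_apex0 R n n_gt4 k n./2 _ _ _ _));
      try lia.
    by apply: chorded_cycle_equivalent; lia.
  apply: (line_equivalent_trans (@avalanche_apex1 R n n_gt4 k n./2 _ _ _ _));
      try lia.
  by apply: chorded_cycle_equivalent; lia.
apply: (line_equivalent_trans (@avalanche_apex0 R n n_gt4 k n _ _ _ _));
      try lia.
by apply: chorded_cycle_equivalent; lia.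
Qed.
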